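(* Let $K$ be a compact Hausdorff topological space. Let $\|\cdot\|_d$ be the norm on $C(K)$ defined by $$\|x\|_d:=\|x^+\|_\infty+\|x^-\|_\infty=\max\{\|x\|_\infty,\rho(x)\},$$ where $\rho(x)=\sup\{|x(s)-x(t)|:s,t\in K\}$ is the diameter seminorm. Then the dual space of $(C(K),\|\cdot\|_d)$ is isometrically isomorphic to the space of regular Borel signed measures on $K$ with the norm $\|\mu\|_0=\max\{\|\mu^+\|_1,\|\mu^-\|_1\}$.
   Context: $C(K)$ is the space of continuous real functions on $K$; $\|x\|_\infty=\sup_{t\in K}|x(t)|$; $x^+,x^-$ are the positive and negative parts of $x$. For a regular Borel signed measure $\mu$, $\mu^+,\mu^-$ are its positive and negative parts and $\|\mu\|_1=|\mu|(K)$ is the variation norm. The isomorphism is the canonical one, associating to $\mu$ the functional $x\mapsto\int_K x\,d\mu$. The displayed equality of the two expressions for $\|x\|_d$ is part of the statement. *)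

(* Defs.v *)
From HB Require Import structures.
From mathcomp Require Import all_boot all_order all_algebra.
From mathcomp Require Import all_classical all_reals all_analysis.
Set Implicit Arguments.
Unset Strict Implicit.
Unset Printing Implicit Defensive.
Import Order.TTheory GRing.Theory Num.Theory.
Import numFieldNormedType.Exports.

Local Open Scope classical_set_scope.
Local Open Scope ring_scope.

(* K is pointed, i.e. nonempty (measurable types are pointed), so the suprema
   below are over nonempty sets; they are bounded when K is compact and x is
   continuous. *)
Section sup_norm.
Context {R : realType} {K : ptopologicalType}.
Implicit Types x : K -> R.

Definition supnorm x : R := sup [set `|x t| | t in [set: K]].

Definition diamnorm x : R :=
  sup [set `|x s - x t| | s in [set: K] & t in [set: K]].

Definition dnorm x : R := supnorm x^\+ + supnorm x^\-.

Let ubP x M : (forall t, `|x t| <= M) ->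
  has_ubound [set `|x t| | t in [set: K]].
Proof. by move=> xM; exists M => _ [t _ <-]. Qed.

Lemma supnorm_ge x M t : (forall t, `|x t| <= M) -> `|x t| <= supnorm x.
Proof. by move=> /ubP /ub_le_sup; apply; exists t. Qed.

Lemma supnorm_le x M : (forall t, `|x t| <= M) -> supnorm x <= M.
Proof.
move=> xM; apply: ge_sup => [|_ [t _ <-]]; last exact: xM.
by exists `|x point|; exists point.
Qed.

Lemma funrpos_le_norm x t : `|x^\+ t| <= `|x t|.
Proof.
rewrite ger0_norm ?funrpos_ge0// /funrpos /Num.max.
by case: ifP => _; rewrite ?normr_ge0// ler_norm.
Qed.

Lemma funrneg_le_norm x t : `|x^\- t| <= `|x t|.
Proof. by rewrite -funrposN (le_trans (funrpos_le_norm _ _))// normrN. Qed.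

Lemma supnormZ x (l M : R) : (forall t, `|x t| <= M) ->
  supnorm (fun t => l * x t) = `|l| * supnorm x.
Proof.
move=> xM; apply/eqP; rewrite eq_le; apply/andP; split.
  apply: supnorm_le => t; rewrite normrM ler_wpM2l//.
  exact: supnorm_ge xM.
have [->|l0] := eqVneq l 0.
  rewrite normr0 mul0r (le_trans (normr_ge0 (0 * x point)))//.
  by apply: (@supnorm_ge _ 0) => t; rewrite mul0r normr0.
rewrite -ler_pdivlMl ?normr_gt0//; apply: supnorm_le => t.
rewrite ler_pdivlMl ?normr_gt0// -normrM.
apply: (@supnorm_ge (fun t => l * x t) (`|l| * M)) => s.
by rewrite normrM ler_wpM2l.
Qed.

Lemma dnormN x : dnorm (\- x) = dnorm x.
Proof. by rewrite /dnorm funrposN funrnegN addrC. Qed.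

Lemma dnormD x y M N : (forall t, `|x t| <= M) -> (forall t, `|y t| <= N) ->
  dnorm (x \+ y) <= dnorm x + dnorm y.
Proof.
move=> xM yN; rewrite /dnorm addrACA.
have H (f g : K -> R) M' N' : (forall t, `|f t| <= M') ->
    (forall t, `|g t| <= N') ->
    supnorm (f \+ g)^\+ <= supnorm f^\+ + supnorm g^\+.
  move=> fM gN; apply: supnorm_le => t.
  have ft : `|f^\+ t| <= supnorm f^\+.
    by apply: (@supnorm_ge _ M') => s; exact: le_trans (funrpos_le_norm _ _) _.
  have gt : `|g^\+ t| <= supnorm g^\+.
    by apply: (@supnorm_ge _ N') => s; exact: le_trans (funrpos_le_norm _ _) _.
  apply: le_trans (lerD ft gt).
  rewrite !ger0_norm ?funrpos_ge0// /funrpos ge_max/= addr_ge0 ?le_max ?lexx ?orbT//.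
  by rewrite andbT lerD// le_max lexx.
apply: lerD; first exact: H xM yN.
rewrite -!funrposN.
rewrite (_ : \- (x \+ y) = (\- x) \+ (\- y)); last first.
  by apply/funext => t /=; rewrite opprD.
by apply: (H _ _ M N) => t /=; rewrite normrN.
Qed.

Lemma dnormZ x l M : (forall t, `|x t| <= M) ->
  dnorm (fun t => l * x t) = `|l| * dnorm x.
Proof.
move=> xM.
have H (r : R) : 0 <= r -> dnorm (fun t => r * x t) = `|r| * dnorm x.
  move=> r0; rewrite /dnorm ge0_funrposM// ge0_funrnegM// mulrDr.
  rewrite (@supnormZ _ _ M); last first.
    by move=> t; exact: le_trans (funrpos_le_norm _ _) _.
  rewrite (@supnormZ _ _ M)//.
  by move=> t; exact: le_trans (funrneg_le_norm _ _) _.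
have [l0|/ltW l0] := leP 0 l; first exact: H.
rewrite -dnormN (_ : \- _ = (fun t => - l * x t)); last first.
  by apply/funext => t; rewrite mulNr.
by rewrite H ?oppr_ge0// normrN.
Qed.

Lemma dnorm_eq0 x M : (forall t, `|x t| <= M) -> dnorm x = 0 ->
  forall t, x t = 0.
Proof.
move=> xM x0 t.
have pt : `|x^\+ t| <= supnorm x^\+.
  by apply: (@supnorm_ge _ M) => s; exact: le_trans (funrpos_le_norm _ _) _.
have nt : `|x^\- t| <= supnorm x^\-.
  by apply: (@supnorm_ge _ M) => s; exact: le_trans (funrneg_le_norm _ _) _.
have := lerD pt nt; rewrite -/(dnorm x) x0 => pn.
have p0 : `|x^\+ t| = 0.
  by apply/eqP; rewrite eq_le normr_ge0 andbT (le_trans _ pn)// lerDl.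
have n0 : `|x^\- t| = 0.
  by apply/eqP; rewrite eq_le normr_ge0 andbT (le_trans _ pn)// lerDr.
by rewrite -(funrposBneg x) /GRing.add/= /GRing.opp/= (normr0_eq0 p0) (normr0_eq0 n0) subrr.
Qed.

End sup_norm.

Section Cd.
Context {R : realType} {K : ptopologicalType}.

(* Compactness of K is a parameter of the type so that its elements are bounded
   and the norm below is well defined. *)
Definition Cd (cK : compact [set: K]) : Type := continuousType K R.

Context (cK : compact [set: K]).
Local Notation C := (Cd cK).

HB.instance Definition _ := Choice.on C.

Lemma CdP (x y : C) : (forall t, x t = y t) -> x = y.
Proof. by move=> xy; apply/(@continuousEP K R). Qed.

Lemma Cd_cts (x : C) : continuous x. Proof. exact: (@cts_fun K R x). Qed.

Lemma Cd_bounded (x : C) : exists M, forall t, `|x t| <= M.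
Proof.
have := @compact_bounded R R^o _ (continuous_compact _ cK).
move=> /(_ x) [|M [_ /(_ (M + 1))]].
  by apply: continuous_subspaceT; exact: Cd_cts.
by rewrite ltrDl => /(_ ltr01) H; exists (M + 1) => t; apply: H; exists t.
Qed.

Definition mkCd (f : K -> R) (cf : continuous f) : C := mkcts cf : continuousType K R.

Let cadd_cts (x y : C) : continuous (fun t => x t + y t).
Proof. by move=> t; exact: (@cvgD R R^o K (nbhs t) _ x y _ _ (@Cd_cts x t) (@Cd_cts y t)). Qed.
Let copp_cts (x : C) : continuous (fun t => - x t).
Proof. by move=> t; exact: (@cvgN R R^o K (nbhs t) _ x _ (@Cd_cts x t)). Qed.
Let cscale_cts (l : R) (x : C) : continuous (fun t => l * x t).
Proof. by move=> t; exact: (@cvgM R K (nbhs t) _ (cst l) x _ _ (cvg_cst _) (@Cd_cts x t)). Qed.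
Let czero_cts : continuous (fun _ : K => 0 : R).
Proof. by move=> t; exact: cvg_cst. Qed.

Definition Cd_add (x y : C) : C := mkCd (@cadd_cts x y).
Definition Cd_opp (x : C) : C := mkCd (@copp_cts x).
Definition Cd_scale (l : R) (x : C) : C := mkCd (@cscale_cts l x).
Definition Cd_zero : C := mkCd czero_cts.

Let addA : associative Cd_add.
Proof. by move=> x y z; apply: CdP => t /=; exact: addrA. Qed.
Let addC : commutative Cd_add.
Proof. by move=> x y; apply: CdP => t /=; exact: addrC. Qed.
Let add0 : left_id Cd_zero Cd_add.
Proof. by move=> x; apply: CdP => t /=; exact: add0r. Qed.
Let addN : left_inverse Cd_zero Cd_opp Cd_add.
Proof. by move=> x; apply: CdP => t /=; exact: addNr. Qed.

HB.instance Definition _ := GRing.isZmodule.Build C addA addC add0 addN.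

Let scaleA a b (x : C) : Cd_scale a (Cd_scale b x) = Cd_scale (a * b) x.
Proof. by apply: CdP => t /=; exact: mulrA. Qed.
Let scale1 : left_id 1 Cd_scale.
Proof. by move=> x; apply: CdP => t /=; exact: mul1r. Qed.
Let scaleDr : right_distributive Cd_scale +%R.
Proof. by move=> l x y; apply: CdP => t /=; exact: mulrDr. Qed.
Let scaleDl (x : C) : {morph Cd_scale^~ x : a b / a + b}.
Proof. by move=> a b; apply: CdP => t /=; exact: mulrDl. Qed.

HB.instance Definition _ :=
  GRing.Zmodule_isLmodule.Build R C scaleA scale1 scaleDr scaleDl.

Let normD (x y : C) : dnorm (x + y) <= dnorm x + dnorm y.
Proof.
have [M xM] := Cd_bounded x; have [N yN] := Cd_bounded y.
exact: dnormD xM yN.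
Qed.

Let normZ l (x : C) : dnorm (l *: x) = `|l| * dnorm x.
Proof. by have [M xM] := Cd_bounded x; exact: dnormZ xM. Qed.

Let norm0 (x : C) : dnorm x = 0 -> x = 0.
Proof.
have [M xM] := Cd_bounded x => x0; apply: CdP => t; exact: dnorm_eq0 xM x0 t.
Qed.

HB.instance Definition _ :=
  @Lmodule_isNormed.Build R C (fun x : C => dnorm x) normD normZ norm0.

End Cd.
Arguments Cd R {K} cK.

Section dual.
Context {R : realType} {V : normedModType R}.

Definition dual_pred : {pred V -> R^o} :=
  [pred f | `[< linear f /\ continuous f >]].

Record dual := Dual {
  dual_fun :> V -> R^o ;
  dual_funP : dual_fun \in dual_pred }.

HB.instance Definition _ := [isSub for dual_fun].
HB.instance Definition _ := [Choice of dual by <:].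

Lemma dual_submod_closed : submod_closed dual_pred.
Proof.
split.
  apply/asboolP; split; last by move=> x; exact: cvg_cst.
  by move=> a x y; rewrite /= /GRing.zero/= scaler0 addr0.
move=> a f g /asboolP[lf cf] /asboolP[lg cg].
apply/asboolP; split.
  move=> b x y; change (a * f (b *: x + y) + g (b *: x + y) =
    b * (a * f x + g x) + (a * f y + g y)).
  rewrite lf lg; change (a * (b * f x + f y) + (b * g x + g y) =
    b * (a * f x + g x) + (a * f y + g y)).
  by rewrite !mulrDr (mulrCA a) addrACA.
move=> x; apply: (@cvgD R R^o); last exact: cg.
by apply: (@cvgZr _ R^o); exact: cf.
Qed.

HB.instance Definition _ :=
  GRing.isSubmodClosed.Build R (V -> R^o) dual_pred dual_submod_closed.
HB.instance Definition _ := [SubChoice_isSubLmodule of dual by <:].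

Let dualP (f : dual) : linear f /\ continuous f.
Proof. exact/asboolP/dual_funP. Qed.

HB.instance Definition _ (f : dual) :=
  GRing.isLinear.Build R V R^o *:%R f (dualP f).1.

Lemma dual_cts (f : dual) : continuous f. Proof. exact: (dualP f).2. Qed.

Definition opnorm (f : V -> R^o) : R :=
  sup [set `|f x| | x in [set x : V | `|x| <= 1]].

Lemma dual_bounded (f : dual) :
  exists M, 0 <= M /\ forall x, `|f x| <= M * `|x|.
Proof.
have /linear_bounded_continuous/linear_boundedP := @dual_cts f.
move=> /pinfty_ex_gt0 [M M0 H]; exists M; split; first exact: ltW.
exact: H.
Qed.

Lemma opnorm_ub (f : dual) x : `|x| <= 1 -> `|f x| <= opnorm f.
Proof.
move=> x1; apply: ub_le_sup; last by exists x.
have [M [M0 fM]] := dual_bounded f; exists M => _ [y /= y1 <-].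
by rewrite (le_trans (fM y))// ler_piMr.
Qed.

Lemma opnorm_le (f : dual) M : (forall x, `|x| <= 1 -> `|f x| <= M) ->
  opnorm f <= M.
Proof.
move=> fM; apply: ge_sup => [|_ [x x1 <-]]; last exact: fM.
by exists `|f 0|; exists 0 => //=; rewrite normr0.
Qed.

Let normD (f g : dual) : opnorm (f + g) <= opnorm f + opnorm g.
Proof.
apply: (@opnorm_le (f + g)) => x x1; rewrite (le_trans (ler_normD _ _))//.
by rewrite lerD// opnorm_ub.
Qed.

Let normZ l (f : dual) : opnorm (l *: f) = `|l| * opnorm f.
Proof.
apply/eqP; rewrite eq_le; apply/andP; split.
  by apply: (@opnorm_le (l *: f)) => x x1; rewrite normrM ler_wpM2l// opnorm_ub.
have [->|l0] := eqVneq l 0.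
  rewrite normr0 mul0r (le_trans (normr_ge0 ((0 *: f : dual) 0)))//.
  by apply: (@opnorm_ub (0 *: f)); rewrite normr0.
rewrite -ler_pdivlMl ?normr_gt0//; apply: opnorm_le => x x1.
rewrite ler_pdivlMl ?normr_gt0// -normrM.
exact: (@opnorm_ub (l *: f)).
Qed.

Let norm0 (f : dual) : opnorm f = 0 -> f = 0.
Proof.
move=> f0; apply/val_inj/funext => x /=.
have [->|x0] := eqVneq x 0; first exact: linear0.
have := @opnorm_ub f (`|x|^-1 *: x).
rewrite f0 normrZ normfV normr_id mulVf ?normr_eq0// lexx => /(_ isT).
rewrite linearZ/= normrZ normfV normr_id.
rewrite pmulr_rle0 ?invr_gt0 ?normr_gt0// normr_le0 => /eqP ->.
by [].
Qed.

HB.instance Definition _ :=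
  @Lmodule_isNormed.Build R dual (fun f : dual => opnorm f) normD normZ norm0.

End dual.
Arguments dual {R} V.

Section charge_norm.
Context d (T : measurableType d) (R : realType).
Implicit Types nu : {charge set T -> \bar R}.
Local Open Scope ereal_scope.

Lemma hahn_ex nu : exists PN : set T * set T, hahn_decomposition nu PN.1 PN.2.
Proof. by have [P [N ?]] := Hahn_decomposition nu; exists (P, N). Qed.

(* By Hahn_decomposition_uniq, the measures below do not depend on which Hahn
   decomposition is chosen. *)
Definition hahn nu : set T * set T := sval (cid (hahn_ex nu)).

Lemma hahnP nu : hahn_decomposition nu (hahn nu).1 (hahn nu).2.
Proof. exact: svalP (cid (hahn_ex nu)). Qed.

(* cpos nu, cneg nu and cvar nu are the positive part, the negative part and
   the total variation measure of nu. *)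
Definition cpos nu : {finite_measure set T -> \bar R} := jordan_pos (hahnP nu).

Definition cneg nu : {finite_measure set T -> \bar R} := jordan_neg (hahnP nu).

Definition cvar nu : {measure set T -> \bar R} := charge_variation (hahnP nu).

Definition tvnorm nu : R := fine (cvar nu [set: T]).

Definition maxnorm nu : R :=
  Num.max (tvnorm (charge_of_finite_measure (cpos nu)))
          (tvnorm (charge_of_finite_measure (cneg nu))).

Definition cintegral nu (x : T -> R) : R :=
  (\int[cpos nu]_t x t - \int[cneg nu]_t x t)%R.

Lemma cposE nu A : measurable A -> cpos nu A = nu (A `&` (hahn nu).1).
Proof. by move=> mA; rewrite /cpos/= jordan_posE cjordan_posE /crestr0 mem_set. Qed.

Lemma cnegE nu A : measurable A -> cneg nu A = - nu (A `&` (hahn nu).2).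
Proof. by move=> mA; rewrite /cneg/= jordan_negE cjordan_negE /crestr0 mem_set. Qed.

Lemma hahn_measurable nu : measurable (hahn nu).1 /\ measurable (hahn nu).2.
Proof. by have [[? _] [? _] _ _] := hahnP nu. Qed.

Lemma cvar_ge nu A : measurable A -> `|nu A| <= cvar nu A.
Proof. exact: abse_charge_variation. Qed.

Lemma cvar_le nu (m : {measure set T -> \bar R}) A :
  (forall B, measurable B -> `|nu B| <= m B) -> measurable A ->
  cvar nu A <= m A.
Proof.
move=> num mA; have [mP mN] := hahn_measurable nu.
have [_ _ PN PN0] := hahnP nu.
rewrite (_ : cvar nu A = cpos nu A + cneg nu A)// cposE// cnegE//.
rewrite -[X in _ <= m X]setIT -PN setIUr measureU//; first last.
- by rewrite setIACA PN0 setI0.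
- exact: measurableI.
- exact: measurableI.
apply: leeD.
  by apply: le_trans (lee_abs _) (num _ _); exact: measurableI.
by apply: le_trans (lee_abs _) _; rewrite abseN; apply: num; exact: measurableI.
Qed.

Lemma charge_le_cpos nu A : measurable A -> nu A <= cpos nu [set: T].
Proof.
move=> mA; apply: (@le_trans _ _ (cpos nu A)); last first.
  by apply: le_measure; rewrite ?inE.
rewrite (jordan_decomp (hahnP nu) mA) /cadd/= cscaleN1/=.
rewrite -[X in _ <= X]adde0; apply: leeD2l.
by rewrite leeNl oppe0 measure_ge0.
Qed.

Lemma charge_ge_cneg nu A : measurable A -> - nu A <= cneg nu [set: T].
Proof.
move=> mA; apply: (@le_trans _ _ (cneg nu A)); last first.
  by apply: le_measure; rewrite ?inE.
rewrite (jordan_decomp (hahnP nu) mA) /cadd/= cscaleN1/=.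
rewrite fin_num_oppeD ?fin_numN ?fin_num_measure// oppeK.
rewrite -[X in _ <= X]add0e; apply: leeD2r.
by rewrite leeNl oppe0 measure_ge0.
Qed.

Lemma tvnorm_measure (m : {finite_measure set T -> \bar R}) :
  tvnorm (charge_of_finite_measure m) = fine (m [set: T]).
Proof.
rewrite /tvnorm; congr fine; apply/eqP; rewrite eq_le; apply/andP; split.
  apply: (@cvar_le (charge_of_finite_measure m) m) => // B mB.
  by rewrite gee0_abs// measure_ge0.
by apply: le_trans (lee_abs _) (@cvar_ge (charge_of_finite_measure m) _ _).
Qed.

Lemma maxnorm_leP nu (M : R) :
  (maxnorm nu <= M)%R <-> forall A, measurable A -> `|nu A| <= M%:E.
Proof.
rewrite /maxnorm !tvnorm_measure ge_max; split.
  move=> /andP[]; rewrite -!lee_fin !fineK ?fin_num_measure// => pM nM A mA.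
  have [nu0|nu0] := leP 0 (nu A).
    by rewrite gee0_abs// (le_trans (charge_le_cpos nu mA)).
  by rewrite lte0_abs// (le_trans (charge_ge_cneg nu mA)).
move=> H; have [mP mN] := hahn_measurable nu.
rewrite -!lee_fin !fineK ?fin_num_measure// cposE// cnegE// !setTI.
apply/andP; split; first exact: le_trans (lee_abs _) (H _ _).
by apply: le_trans (lee_abs _) _; rewrite abseN; exact: H.
Qed.

Lemma le_maxnorm nu A : measurable A -> `|nu A| <= (maxnorm nu)%:E.
Proof. by move=> mA; have /maxnorm_leP := lexx (maxnorm nu); apply. Qed.

Lemma charge_ext (mu nu : {charge set T -> \bar R}) :
  (forall A, mu A = nu A) -> mu = nu.
Proof.
case: mu nu => [m [[a] [b] [c]]] [n [[a'] [b'] [c']]] /= /funext mn.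
subst n; congr Charge.Pack; congr Charge.Class.
- congr isSemiSigmaAdditive.Axioms_; exact: Prop_irrelevance.
- congr isAdditiveCharge.Axioms_; exact: Prop_irrelevance.
- congr isFinite.Axioms_; exact: Prop_irrelevance.
Qed.

End charge_norm.

Section rca.
Context {R : realType} {K : ptopologicalType}.
Local Notation borel := (g_sigma_algebraType (@open K)).
Local Open Scope ereal_scope.

(* K being compact Hausdorff in the applications, the closed sets F are exactly
   the compact ones. *)
Definition regular_charge (nu : {charge set borel -> \bar R}) :=
  forall (A : set borel) (e : R), measurable A -> (0 < e)%R ->
  exists F U : set K, [/\ closed F, open U, F `<=` A, A `<=` U &
    cvar nu (U `\` F) < e%:E].

(* A charge is a function on all subsets; requiring it to vanish off the Borel
   sets makes equality of charges coincide with equality on the Borel sets. *)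
Record rca := Rca {
  rca_charge :> {charge set borel -> \bar R} ;
  rca_regular : regular_charge rca_charge ;
  rca_nonborel : forall A : set borel, ~ measurable A -> rca_charge A = 0 }.

HB.instance Definition _ := gen_eqMixin rca.
HB.instance Definition _ := gen_choiceMixin rca.

Implicit Types mu nu : rca.

Lemma rcaP mu nu : (forall A, mu A = nu A) -> mu = nu.
Proof.
case: mu nu => [m mr m0] [n nr n0] /= /charge_ext mn; subst n.
by congr Rca; exact: Prop_irrelevance.
Qed.

Lemma rca_fin mu A : mu A \is a fin_num.
Proof.
have [mA|mA] := pselect (@measurable _ borel A); first exact: fin_num_measure.
by rewrite rca_nonborel.
Qed.

Lemma borel_open (U : set K) : open U -> @measurable _ borel U.
Proof. by move=> oU; exact: sub_sigma_algebra. Qed.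

Lemma borel_closed (F : set K) : closed F -> @measurable _ borel F.
Proof.
move=> cF; rewrite -[F]setCK; apply: measurableC; apply: borel_open.
by apply/closed_openC.
Qed.

Lemma regular_le (nu : {charge set borel -> \bar R}) (a b : {nonneg R})
    (mu1 mu2 : {charge set borel -> \bar R}) :
  regular_charge mu1 -> regular_charge mu2 ->
  (forall A, measurable A ->
     `|nu A| <= a%:num%:E * cvar mu1 A + b%:num%:E * cvar mu2 A) ->
  regular_charge nu.
Proof.
move=> r1 r2 H A e mA e0.
pose c := (1 + a%:num + b%:num)%R.
have c0 : (0 < c)%R by rewrite /c -addrA ltr_pwDl.
have e2 : (0 < e / c / 2)%R by rewrite !divr_gt0.
have [F1 [U1 [cF1 oU1 F1A AU1 d1]]] := r1 A _ mA e2.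
have [F2 [U2 [cF2 oU2 F2A AU2 d2]]] := r2 A _ mA e2.
exists (F1 `|` F2), (U1 `&` U2); split.
- exact: closedU.
- exact: openI.
- by rewrite subUset.
- by rewrite subsetI.
pose D : set borel := (U1 `&` U2) `\` (F1 `|` F2).
have mD : measurable D.
  apply: measurableD; first by apply: measurableI; exact: borel_open.
  by apply: measurableU; exact: borel_closed.
have m1 : cvar mu1 D < (e / c / 2)%:E.
  apply: le_lt_trans d1; apply: le_measure; rewrite ?inE//.
    by apply: measurableD; [exact: borel_open|exact: borel_closed].
  by move=> t [[? _] nF]; split => // ?; apply: nF; left.
have m2 : cvar mu2 D < (e / c / 2)%:E.
  apply: le_lt_trans d2; apply: le_measure; rewrite ?inE//.
    by apply: measurableD; [exact: borel_open|exact: borel_closed].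
  by move=> t [[_ ?] nF]; split => // ?; apply: nF; right.
pose m : {measure set borel -> \bar R} :=
  measure_add (mscale a (cvar mu1)) (mscale b (cvar mu2)).
have mE B : m B = a%:num%:E * cvar mu1 B + b%:num%:E * cvar mu2 B.
  exact: measure_addE.
apply: (@le_lt_trans _ _ (m D)).
  by apply: cvar_le => // B mB; rewrite mE; exact: H.
rewrite mE.
apply: (@le_lt_trans _ _ (a%:num%:E * (e / c / 2)%:E + b%:num%:E * (e / c / 2)%:E)).
  by apply: leeD; apply: lee_wpmul2l; rewrite ?lee_fin//; exact: ltW.
rewrite -!EFinM -EFinD lte_fin -mulrDl.
rewrite -[ltRHS](@divfK _ c) ?gt_eqF// [ltRHS]mulrC.
have ec : (0 < e / c)%R by rewrite divr_gt0.
rewrite ltr_pM ?divr_ge0 ?addr_ge0// ?(ltW e0) ?(ltW c0)//.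
  by rewrite /c -addrA ltrDr.
by rewrite ltr_pdivrMr// ltr_pMr// ltr1n.
Qed.

Let zero_reg : regular_charge czero.
Proof.
move=> A e mA e0; exists set0, setT; split => //.
- exact: closed0.
- exact: openT.
apply: (@le_lt_trans _ _ (@mzero _ borel R setT)); last by rewrite lte_fin.
rewrite setD0; apply: (@cvar_le _ _ _ czero mzero) => // B mB.
by rewrite abse0.
Qed.

Let add_reg mu nu : regular_charge (cadd mu nu).
Proof.
apply: (@regular_le _ (1%:nng)%R (1%:nng)%R mu nu); [exact: rca_regular..|].
move=> A mA; rewrite !mul1e (le_trans (lee_abs_add _ _))//.
by apply: leeD; exact: cvar_ge.
Qed.

Let scale_reg (l : R) mu : regular_charge (cscale l mu).
Proof.
apply: (@regular_le _ (`|l|%:nng)%R (0%:nng)%R mu mu); [exact: rca_regular..|].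
move=> A mA; rewrite mul0e adde0 /= /cscale abseM; apply: lee_wpmul2l => //.
exact: cvar_ge.
Qed.

Let zero0 (A : set borel) : ~ measurable A -> @czero _ borel R A = 0.
Proof. by []. Qed.
Let add0 mu nu (A : set borel) : ~ measurable A -> cadd mu nu A = 0.
Proof. by move=> nA; rewrite /cadd/= !rca_nonborel// adde0. Qed.
Let scale0 (l : R) mu (A : set borel) : ~ measurable A -> cscale l mu A = 0.
Proof. by move=> nA; rewrite /cscale rca_nonborel// mule0. Qed.

Definition rca_zero := Rca zero_reg zero0.
Definition rca_add mu nu := Rca (@add_reg mu nu) (@add0 mu nu).
Definition rca_scale l mu := Rca (@scale_reg l mu) (@scale0 l mu).
Definition rca_opp mu := rca_scale (-1) mu.

Let addA : associative rca_add.
Proof. by move=> m n p; apply: rcaP => A; exact: addeA. Qed.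
Let addC : commutative rca_add.
Proof. by move=> m n; apply: rcaP => A; exact: addeC. Qed.
Let add_0 : left_id rca_zero rca_add.
Proof. by move=> m; apply: rcaP => A; exact: add0e. Qed.
Let addN : left_inverse rca_zero rca_opp rca_add.
Proof.
move=> m; apply: rcaP => A; change ((-1)%:E * m A + m A = 0).
by rewrite mulN1e addeC subee// rca_fin.
Qed.

HB.instance Definition _ := GRing.isZmodule.Build rca addA addC add_0 addN.

Let scaleA a b mu : rca_scale a (rca_scale b mu) = rca_scale (a * b)%R mu.
Proof. by apply: rcaP => A; rewrite /= /cscale EFinM muleA. Qed.
Let scale1 : left_id 1%R rca_scale.
Proof. by move=> m; apply: rcaP => A; exact: mul1e. Qed.
Let scaleDr : right_distributive rca_scale +%R.
Proof.
move=> l m n; apply: rcaP => A.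
by change (l%:E * (m A + n A) = l%:E * m A + l%:E * n A); rewrite muleDr ?fin_num_adde_defl ?rca_fin.
Qed.
Let scaleDl mu : {morph rca_scale^~ mu : a b / (a + b)%R}.
Proof.
move=> a b; apply: rcaP => A.
by change ((a%:E + b%:E) * mu A = a%:E * mu A + b%:E * mu A); rewrite muleDl ?rca_fin.
Qed.

HB.instance Definition _ :=
  GRing.Zmodule_isLmodule.Build R rca scaleA scale1 scaleDr scaleDl.

Let normD mu nu : (maxnorm (mu + nu)%R <= maxnorm mu + maxnorm nu)%R.
Proof.
apply/maxnorm_leP => A mA; change (`|mu A + nu A| <= (maxnorm mu + maxnorm nu)%:E).
by rewrite EFinD (le_trans (lee_abs_add _ _))// leeD// le_maxnorm.
Qed.

Let normZ_le (l : R) mu : (maxnorm (l *: mu)%R <= `|l| * maxnorm mu)%R.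
Proof.
apply/maxnorm_leP => A mA; change (`|l%:E * mu A| <= (`|l| * maxnorm mu)%:E).
by rewrite abseM EFinM lee_wpmul2l// le_maxnorm.
Qed.

Let maxnorm_ge0 mu : (0 <= maxnorm mu)%R.
Proof.
by rewrite -lee_fin (le_trans (abse_ge0 _) (le_maxnorm mu measurableT)).
Qed.

Let normZ (l : R) mu : maxnorm (l *: mu)%R = (`|l| * maxnorm mu)%R.
Proof.
apply/eqP; rewrite eq_le normZ_le andTb.
have [l0|l0] := eqVneq l 0%R.
  have -> : (`|l| * maxnorm mu = 0)%R by rewrite l0 normr0 mul0r.
  exact: (@maxnorm_ge0 (l *: mu)%R).
rewrite -ler_pdivlMl ?normr_gt0// -normfV.
by have := normZ_le l^-1 (l *: mu); rewrite scalerA mulVf// scale1r.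
Qed.

Let norm0 mu : maxnorm mu = 0%R -> mu = 0%R.
Proof.
move=> m0; apply: rcaP => A; change (mu A = 0).
have [mA|mA] := pselect (@measurable _ borel A); last exact: rca_nonborel.
apply/eqP; rewrite -abse_eq0 eq_le abse_ge0 andbT.
by have := le_maxnorm mu mA; rewrite m0.
Qed.

HB.instance Definition _ :=
  @Lmodule_isNormed.Build R rca (fun mu : rca => maxnorm mu) normD normZ norm0.

End rca.
Arguments rca R K : clear implicits.

Definition isometric_isomorphism {R : realType} {V W : normedModType R}
  (f : {linear V -> W}) := bijective f /\ forall v, `|f v| = `|v|.

(* Main.v *)
From HB Require Import structures.
Require Import Defs.
From mathcomp Require Import all_boot all_order all_algebra.
From mathcomp Require Import all_classical all_reals all_analysis.
From mathcomp Require Import finmap measurable_realfun lra.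
Set Implicit Arguments.
Unset Strict Implicit.
Unset Printing Implicit Defensive.
Import Order.TTheory GRing.Theory Num.Theory.
Import numFieldNormedType.Exports.
Local Open Scope classical_set_scope.
Local Open Scope ring_scope.

(** The canonical map sends a measure mu to integration against mu, and the
    theorem says that this map is isometric and onto.

    Isometric: write P and N for the positive and the negative part of mu. Since
    - sup x^- <= x <= sup x^+ pointwise, the integral of x is at most
    (sup x^+) P(K) + (sup x^-) N(K), hence at most
    max (P(K), N(K)) (sup x^+ + sup x^-), which is [cintegral_le]. Conversely
    max (P(K), N(K)) is the supremum of |mu A| over the Borel sets A, attained
    on a Hahn decomposition. Regularity encloses A between a closed set F and an
    open set U that differ by little, and a Urysohn function g that is 1 on F
    and 0 off U satisfies 0 <= g <= 1, so sup g^+ + sup g^- <= 1, while its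
    integral is close to mu A ([maxnorm_le_cintegral]). Isometric implies
    injective.

    Onto: this is the Riesz representation theorem ([riesz_signed]). A bounded
    functional f is, on nonnegative functions, the difference of the functional
    x |-> sup {f y | 0 <= y <= x} and of the same one for - f ([upperB]); both
    are nonnegative and additive ([upper_positive]). It remains to represent one
    such p ([riesz_positive]). On an open set U the measure has to be the
    supremum of the p x over the continuous x with 0 <= x <= 1 that vanish off
    U. Compactness makes this content countably subadditive
    ([open_content_sigma]), so that the infimum of the content over the open
    sets containing a set is an outer measure. A function below U and a function
    living where the former is small can be added without exceeding 1
    ([open_content_disjoint]); that is why open sets are measurable in the sense
    of Caratheodory. Finally p x is the integral of x: cutting x into horizontal
    slices of height d bounds p x by the integral of x up to an error of d m(K)
    ([functional_le_slice]), and the reverse inequality is the same one for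
    M - x, where M is an upper bound of x.

    Linearity of the canonical map in mu is not immediate, because the Jordan
    decomposition is not linear; but an integral against mu may be computed from
    any expression of mu as a difference of finite measures
    ([cintegral_diff]). *)

Local Notation borel K := (g_sigma_algebraType (@open K)).

(** * Positive functionals and the content of open sets *)

Section continuity.
Context {R : realType} {K : topologicalType}.
Implicit Types x y : K -> R.

Lemma ctsD x y : continuous x -> continuous y ->
  continuous (fun t => x t + y t).
Proof. by move=> cx cy t; apply: cvgD; [exact: cx|exact: cy]. Qed.

Lemma ctsB x y : continuous x -> continuous y ->
  continuous (fun t => x t - y t).
Proof. by move=> cx cy t; apply: cvgB; [exact: cx|exact: cy]. Qed.

Lemma ctsM x y : continuous x -> continuous y ->
  continuous (fun t => x t * y t).
Proof. by move=> cx cy t; apply: cvgM; [exact: cx|exact: cy]. Qed.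

Lemma cts_cst (c : R) : continuous (fun _ : K => c).
Proof. by move=> t; exact: cvg_cst. Qed.

Lemma cts_max x y : continuous x -> continuous y ->
  continuous (fun t => Num.max (x t) (y t)).
Proof. by move=> cx cy t; apply: continuous_max; [exact: cx|exact: cy]. Qed.

Lemma cts_min x y : continuous x -> continuous y ->
  continuous (fun t => Num.min (x t) (y t)).
Proof. by move=> cx cy t; apply: continuous_min; [exact: cx|exact: cy]. Qed.

Lemma closed_superlevel x (c : R) : continuous x -> closed [set t | c <= x t].
Proof.
move=> cx; apply: (@closed_comp _ _ x [set r | c <= r]) => [t _|].
  exact: cx.
exact: closed_ge.
Qed.

Lemma open_superlevel x (c : R) : continuous x -> open [set t | c < x t].
Proof.
move=> cx; apply: (@open_comp _ _ x [set r | c < r]) => [t _|].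
  exact: cx.
exact: open_gt.
Qed.

End continuity.

Section positive_functional.
Context {R : realType} {K : ptopologicalType}.
Implicit Types (x y : K -> R) (p : (K -> R) -> R) (U V : set K).

(** Functionals are constrained on this cone only: the positive part of a
    bounded functional is a supremum that is additive there, not elsewhere. *)
Definition cone x := continuous x /\ forall t, 0 <= x t.

Definition positive_functional p :=
  [/\ forall x, cone x -> 0 <= p x,
      forall x y, cone x -> cone y -> p (fun t => x t + y t) = p x + p y &
      forall (c : R) x, 0 <= c -> cone x -> p (fun t => c * x t) = c * p x].

(** This is (x - e)^+. When e > 0 and x vanishes off U, it is carried by {x >= e},
    a closed subset of U if x is continuous. *)
Definition trunc (e : R) x : K -> R := fun t => Num.max (x t - e) 0.

Definition below U x :=
  [/\ continuous x, forall t, 0 <= x t <= 1 & forall t, ~ U t -> x t = 0].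

(** The value on U of the measure that represents p, when U is open. *)
Definition open_content p U : R := sup [set p x | x in below U].

Lemma cone_cst (c : R) : 0 <= c -> cone (fun=> c).
Proof. by move=> c0; split=> //; exact: cts_cst. Qed.

Lemma cone_trunc e x : continuous x -> cone (trunc e x).
Proof.
move=> cx; split=> [|t]; last by rewrite le_max lexx orbT.
by apply: cts_max; [apply: ctsB => //; exact: cts_cst|exact: cts_cst].
Qed.

Lemma below_cone {U x} : below U x -> cone x.
Proof. by case=> cx x01 _; split=> // t; case/andP: (x01 t). Qed.

Lemma below0 U : below U (fun=> 0).
Proof. by split=> //; [exact: cts_cst|move=> t; rewrite lexx ler01]. Qed.

Lemma sub_below U V x : U `<=` V -> below U x -> below V x.
Proof. by move=> UV [cx x01 x0]; split=> // t Vt; apply: x0 => /UV. Qed.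

Lemma trunc_le1 e x t : 0 <= e -> 0 <= x t <= 1 -> 0 <= trunc e x t <= 1.
Proof.
move=> e0 /andP[x0 x1].
by rewrite le_max lexx orbT ge_max ler01 andbT lerBlDr (le_trans x1)// lerDl.
Qed.

Section fixed.
Context {p : (K -> R) -> R} (pp : positive_functional p).

Let p_ge0 x : cone x -> 0 <= p x.
Proof. by case: pp => H _ _; exact: H. Qed.
Let pD x y : cone x -> cone y -> p (fun t => x t + y t) = p x + p y.
Proof. by case: pp => _ H _; exact: H. Qed.
Let pZ (c : R) x : 0 <= c -> cone x -> p (fun t => c * x t) = c * p x.
Proof. by case: pp => _ _ H; exact: H. Qed.

Lemma functional_le x y : cone x -> cone y -> (forall t, x t <= y t) ->
  p x <= p y.
Proof.
move=> [cx x0] [cy y0] xy.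
have cB : cone (fun t => y t - x t).
  by split=> [|t]; [exact: ctsB|rewrite subr_ge0].
rewrite (_ : y = fun t => x t + (y t - x t)); last first.
  by apply/funext => t; rewrite addrC subrK.
by rewrite pD// lerDl p_ge0.
Qed.

Lemma functional_cst (c : R) : 0 <= c -> p (fun=> c) = c * p (fun=> 1).
Proof.
move=> c0; rewrite -pZ//; last by apply: cone_cst.
by congr p; apply/funext => t; rewrite mulr1.
Qed.

Lemma functional_trunc e x : 0 <= e -> cone x ->
  p x <= p (trunc e x) + e * p (fun=> 1).
Proof.
move=> e0 cx; have ct := cone_trunc e cx.1.
rewrite -functional_cst// -pD//; last by apply: cone_cst.
apply: functional_le => // [|t].
  split=> [|t]; first by apply: ctsD; [case: ct|exact: cts_cst].
  by apply: addr_ge0 => //; case: ct.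
by rewrite -lerBlDr le_max lexx.
Qed.

Lemma open_content_ub U x : below U x -> p x <= open_content p U.
Proof.
move=> Ux; apply: ub_le_sup; last by exists x.
exists (p (fun=> 1)) => _ [y Uy <-].
apply: functional_le; [exact: below_cone Uy|exact: cone_cst|].
by case: Uy => _ y01 _ t; case/andP: (y01 t).
Qed.

(** Truncated functions suffice, because truncating x at e costs at most e times
    the value of p at the constant 1. *)
Lemma open_content_le U M :
  (forall e x, 0 < e -> below U x -> p (trunc e x) <= M) ->
  open_content p U <= M.
Proof.
move=> H; apply: ge_sup.
  by exists (p (fun=> 0)), (fun=> 0) => //; exact: below0.
move=> _ [x Ux <-]; have p1 := p_ge0 (cone_cst ler01).
apply/ler_addgt0Pr => e e0.
have d0 : 0 < e / (p (fun=> 1) + 1) by rewrite divr_gt0// ltr_wpDl.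
apply: le_trans (functional_trunc (ltW d0) (below_cone Ux)) _.
apply: lerD; first exact: H.
rewrite -mulrA ler_piMr ?(ltW e0)// mulrC ler_pdivrMr ?mul1r ?lerDl//.
exact: ltr_wpDl.
Qed.

Lemma open_content_mono U V : U `<=` V -> open_content p U <= open_content p V.
Proof.
move=> UV; apply: open_content_le => e x e0 Ux.
apply: le_trans (open_content_ub (sub_below UV Ux)).
have cx := below_cone Ux; apply: functional_le => //.
  exact: cone_trunc cx.1.
by move=> t; rewrite ge_max cx.2 andbT lerBlDr lerDl ltW.
Qed.

Lemma open_content_ge0 U : 0 <= open_content p U.
Proof.
apply: le_trans (open_content_ub (below0 U)); apply: p_ge0; exact: cone_cst.
Qed.

Lemma open_content0 : open_content p set0 = 0.
Proof.
apply/eqP; rewrite eq_le open_content_ge0 andbT.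
apply: open_content_le => e x e0 [_ _ x0].
rewrite (_ : trunc e x = fun=> 0); first by rewrite functional_cst// mul0r.
by apply/funext => t; rewrite /trunc x0// sub0r max_r// oppr_le0 ltW.
Qed.

Lemma open_contentT : open_content p [set: K] = p (fun=> 1).
Proof.
apply/eqP; rewrite eq_le; apply/andP; split; last first.
  apply: open_content_ub; split=> [|t|t /(_ I)//]; first exact: cts_cst.
  by rewrite ler01 lexx.
apply: open_content_le => e x e0 [cx x01 _].
apply: functional_le; [exact: cone_trunc|exact: cone_cst|move=> t].
by case/andP: (trunc_le1 (ltW e0) (x01 t)).
Qed.

End fixed.
End positive_functional.

(** * Open sets: compactness and additivity *)

Section open_content_compact.
Context {R : realType} {K : ptopologicalType}.
Context (cK : compact [set: K]) (hK : hausdorff_space K).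
Implicit Types (x y : K -> R) (U V F : set K).

Lemma urysohn_below F U : closed F -> open U -> F `<=` U ->
  exists2 g, below U g & forall t, F t -> g t = 1 :> R.
Proof.
move=> cF oU FU.
have nK : normal_space K by exact: compact_normal.
have /(@uniform_separatorP _ R)[g [cg g01 g0 g1]] : uniform_separator (~` U) F.
  apply: (proj1 (@normal_separatorP R K) nK) => //; first exact: open_closedC.
  by apply/disjoints_subset; exact: subsetC.
exists g; last by move=> t Ft; apply: g1; exists t.
split=> // t; last by move=> Ut; apply: g0; exists t.
by have /g01 : range g (g t) by []; rewrite /= in_itv.
Qed.

Context {p : (K -> R) -> R} (pp : positive_functional p).

(** A Urysohn function g, equal to 1 on the part of {x >= e} outside U and to 0
    outside V, splits the truncation z of x into (1 - g) z, which vanishes off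
    U, and g z, which vanishes off V. *)
Lemma open_contentU U V : open U -> open V ->
  open_content p (U `|` V) <= open_content p U + open_content p V.
Proof.
move=> oU oV; apply: (open_content_le pp) => e x e0 [cx x01 x0].
pose F := [set t | e <= x t] `&` ~` U.
have cF : closed F.
  by apply: closedI; [exact: closed_superlevel|exact: open_closedC].
have FV : F `<=` V.
  move=> t [/= ex Ut]; apply: contrapT => Vt.
  by move: ex; rewrite x0 ?leNgt ?e0// => -[].
have [g [cg g01 g0] g1] := urysohn_below cF oV FV.
have [ctx tx0] := @cone_trunc _ _ e _ cx.
have tx01 t : 0 <= trunc e x t <= 1 by exact: trunc_le1 (ltW e0) (x01 t).
have b1 : below U (fun t => (1 - g t) * trunc e x t).
  split.
  - by apply: ctsM => //; apply: ctsB => //; exact: cts_cst.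
  - move=> t; case/andP: (tx01 t) => a b; case/andP: (g01 t) => c d.
    by rewrite mulr_ge0 ?subr_ge0// mulr_ile1// ?subr_ge0// gerBl.
  - move=> t Ut; have [ex|ex] := leP e (x t).
      by rewrite g1 ?subrr ?mul0r//; split.
    by rewrite /trunc max_r ?mulr0// subr_le0 ltW.
have b2 : below V (fun t => g t * trunc e x t).
  split; first exact: ctsM.
    move=> t; case/andP: (tx01 t) => a b; case/andP: (g01 t) => c d.
    by rewrite mulr_ge0// mulr_ile1.
  by move=> t Vt; rewrite g0// mul0r.
rewrite (_ : trunc e x =
    fun t => (1 - g t) * trunc e x t + g t * trunc e x t); last first.
  by apply/funext => t; rewrite -mulrDl subrK mul1r.
have [_ pD _] := pp; rewrite (pD _ _ (below_cone b1) (below_cone b2)).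
by apply: lerD; apply: (open_content_ub pp).
Qed.

Lemma open_content_bigU (F : (set K)^nat) n : (forall i, open (F i)) ->
  open_content p (\big[setU/set0]_(i < n) F i) <=
  \sum_(i < n) open_content p (F i).
Proof.
move=> oF; elim: n => [|n IH]; first by rewrite !big_ord0 (open_content0 pp).
rewrite !big_ord_recr/=; apply: le_trans (lerD IH (lexx _)).
apply: open_contentU => //.
by rewrite -bigcup_mkord; apply: bigcup_open => i _; exact: oF.
Qed.

(** The set {x >= e} is compact, so that the truncation of a function below the
    union already lies below a finite union. *)
Lemma open_content_sigma (F : (set K)^nat) : (forall i, open (F i)) ->
  ((open_content p (\bigcup_i F i))%:E <=
   \sum_(i <oo) (open_content p (F i))%:E)%E.
Proof.
move=> oF.
have fin n : ((open_content p (\big[setU/set0]_(i < n) F i))%:E <=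
    \sum_(i <oo) (open_content p (F i))%:E)%E.
  apply: le_trans (nneseries_lim_ge n _); last first.
    by move=> i _ _; rewrite lee_fin (open_content_ge0 pp).
  by rewrite sumEFin lee_fin big_mkord; exact: open_content_bigU.
have [->|sfin] := eqVneq (\sum_(i <oo) (open_content p (F i))%:E)%E +oo%E.
  exact: leey.
have sE : (\sum_(i <oo) (open_content p (F i))%:E)%E \is a fin_num.
  rewrite ge0_fin_numE ?ltey//.
  by apply: nneseries_ge0 => i _ _; rewrite lee_fin (open_content_ge0 pp).
rewrite -(fineK sE) lee_fin; apply: (open_content_le pp) => e x e0 [cx x01 x0].
have cC : compact [set t | e <= x t].
  by apply: (subclosed_compact _ cK) => //; exact: closed_superlevel.
move: cC; rewrite compact_cover => /(_ nat setT F (fun i _ => oF i)).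
have xF : [set t | e <= x t] `<=` cover setT F.
  move=> t /= ex; apply: contrapT => Ft.
  by move: ex; rewrite x0 ?leNgt ?e0.
move=> /(_ xF)[D _ DF].
pose n := (\max_(i <- D) i).+1.
rewrite -lee_fin fineK//; apply: le_trans (fin n); rewrite lee_fin.
apply: (open_content_ub pp); split; first by case: (@cone_trunc _ _ e _ cx).
  by move=> t; exact: trunc_le1 (ltW e0) (x01 t).
move=> t Ft; rewrite /trunc max_r// subr_le0 leNgt; apply/negP => ex.
apply: Ft; have [i Di Fi] := DF _ (ltW ex).
by rewrite -bigcup_mkord; exists i => //=; rewrite ltnS; exact: leq_bigmax_seq.
Qed.

(** The truncation of x vanishes on V, so that its sum with a function below V
    does not exceed 1. This is the superadditivity that makes open sets
    Caratheodory measurable. *)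
Lemma open_content_disjoint U V W e x : 0 < e -> below U x -> U `<=` W ->
  V `<=` W -> (forall t, V t -> x t < e) ->
  p (trunc e x) + open_content p V <= open_content p W.
Proof.
move=> e0 Ux UW VW Vx; rewrite addrC -lerBrDr.
apply: ge_sup; first by exists (p (fun=> 0)), (fun=> 0) => //; exact: below0.
move=> _ [y Vy <-]; rewrite lerBrDr addrC.
have [cx x01 x0] := Ux; have [cy' y01 y0] := Vy.
have ct := @cone_trunc _ _ e _ cx; have cy := below_cone Vy.
have [_ pD _] := pp; rewrite -pD//; apply: (open_content_ub pp).
split.
- by apply: ctsD => //; case: ct.
- move=> t; have [Vt|Vt] := pselect (V t); last first.
    by rewrite y0// addr0 trunc_le1// ltW.
  by rewrite /trunc max_r ?add0r// subr_le0 ltW// Vx.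
- move=> t Wt; rewrite y0 => [|/VW//]; rewrite addr0 /trunc x0 => [|/UW//].
  by rewrite sub0r max_r// oppr_le0 ltW.
Qed.

End open_content_compact.

(** * The Borel measure of a positive functional *)

(** The sets that are measurable in the sense of Caratheodory form a
    sigma-algebra, which contains the Borel sets once it contains the open
    ones. *)
Lemma outer_measure_borel {R : realType} {K : ptopologicalType}
    (mu : {outer_measure set K -> \bar R}) :
  (forall U, open U -> mu.-caratheodory U) -> (mu [set: K] < +oo)%E ->
  exists m : {finite_measure set (borel K) -> \bar R}, forall A, m A = mu A.
Proof.
move=> oC muT.
have bC (A : set (borel K)) : measurable A -> mu.-caratheodory A.
  apply: (@smallest_sub _ (@sigma_algebra K setT) _ mu.-caratheodory) => //.
  split; first exact: caratheodory_measurable_set0.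
    by move=> B mB; rewrite setTD; exact: caratheodory_measurable_setC.
  exact: caratheodory_measurable_bigcup.
pose m : set (borel K) -> \bar R := mu.
have m0 : m set0 = 0%E by exact: outer_measure0.
have mge0 A : (0 <= m A)%E by exact: outer_measure_ge0.
have msigma : semi_sigma_additive m.
  move=> F mF tF mUF.
  apply: (@caratheodory_measure_sigma_additive _ _ mu F) => //.
    by move=> i; exact: bC.
  exact: bC.
have mfin : fin_num_fun m.
  move=> A _; rewrite ge0_fin_numE//; apply: le_lt_trans muT.
  exact: le_outer_measure.
pose M0 := isMeasure.Build _ _ _ m m0 mge0 msigma.
pose M1 : {measure set (borel K) -> \bar R} := HB.pack m M0.
pose M2 := Measure_isFinite.Build _ _ _ M1 mfin.
pose M3 : {finite_measure set (borel K) -> \bar R} := HB.pack m M1 M2.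
by exists M3.
Qed.

Section outer.
Context {R : realType} {K : ptopologicalType}.
Context (cK : compact [set: K]) (hK : hausdorff_space K).
Context {p : (K -> R) -> R} (pp : positive_functional p).
Implicit Types (A U V W : set K).
Local Open Scope ereal_scope.

Let outer A : \bar R :=
  ereal_inf [set (open_content p U)%:E | U in [set U | open U /\ A `<=` U]].

Let outer_le A U : open U -> A `<=` U -> outer A <= (open_content p U)%:E.
Proof. by move=> oU AU; apply: ereal_inf_lbound; exists U. Qed.

Let outer_open U : open U -> outer U = (open_content p U)%:E.
Proof.
move=> oU; apply/eqP; rewrite eq_le outer_le//=.
apply: le_ereal_inf_tmp => _ [V [oV UV] <-].
by rewrite lee_fin (open_content_mono pp).
Qed.

Let outer_ge0 A : 0 <= outer A.
Proof.
by apply: le_ereal_inf_tmp => _ [V _ <-]; rewrite lee_fin (open_content_ge0 pp).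
Qed.

Let outer_adherent A (e : R) : (0 < e)%R ->
  exists U, [/\ open U, A `<=` U & (open_content p U)%:E <= outer A + e%:E].
Proof.
move=> e0; have Afin : outer A \is a fin_num.
  rewrite ge0_fin_numE//; apply: le_lt_trans (ltry (open_content p setT)).
  by apply: outer_le => //; exact: openT.
have [_ [U [oU AU] <-] /ltW ?] := lb_ereal_inf_adherent e0 Afin.
by exists U.
Qed.

Let outer0 : outer set0 = 0.
Proof. by rewrite outer_open ?(open_content0 pp)//; exact: open0. Qed.

Let outer_sigma A (F : (set K)^nat) : subset_sigma_subadditive outer A F.
Proof.
move=> AF; apply/lee_addgt0Pr => e e0.
have e2 n : (0 < e / (2 ^ n.+1)%:R)%R by rewrite divr_gt0// ltr0n expn_gt0.
have /choice[G HG] n := outer_adherent (F n) (e2 n).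
apply: le_trans (epsilon_trick xpredT _ (ltW e0)) => //.
apply: (@le_trans _ _ (\sum_(i <oo) (open_content p (G i))%:E)); last first.
  apply: lee_nneseries => [i _ _|i _]; last by case: (HG i).
  by rewrite lee_fin (open_content_ge0 pp).
apply: le_trans (open_content_sigma cK hK pp _); last by move=> i; case: (HG i).
apply: outer_le; first by apply: bigcup_open => i _; case: (HG i).
by move=> t /AF[i _ Fi]; exists i => //; case: (HG i) => _ + _; apply.
Qed.

Let outer_mixin :=
  isSubsetOuterMeasure.Build R K outer outer0 outer_ge0 outer_sigma.

Let mu : {outer_measure set K -> \bar R} := HB.pack outer outer_mixin.

Let outer_caratheodory U : open U -> mu.-caratheodory U.
Proof.
move=> oU; apply: le_caratheodory_measurable => A; apply/lee_addgt0Pr => e e0.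
have [W [oW AW We]] := outer_adherent A e0; apply: le_trans We.
apply: (@le_trans _ _ ((open_content p (W `&` U))%:E + mu (W `&` ~` U))).
  apply: leeD; last by apply: le_outer_measure; exact: setSI.
  by apply: outer_le; [exact: openI|exact: setSI].
have Dfin : mu (W `&` ~` U) \is a fin_num.
  rewrite ge0_fin_numE ?outer_measure_ge0//.
  apply: le_lt_trans (ltry (open_content p W)); apply: outer_le => //.
rewrite -(fineK Dfin) -EFinD lee_fin -lerBrDr.
apply: (open_content_le pp) => d x d0 Wx; rewrite lerBrDr.
(* W `\` U lies in the open set V, on which the truncation of x vanishes. *)
pose V := W `&` [set t | (x t < d)%R].
have Vx t : V t -> (x t < d)%R by case.
have UW : W `&` U `<=` W by exact: subIsetl.
have VW : V `<=` W by exact: subIsetl.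
apply: le_trans (open_content_disjoint pp d0 Wx UW VW Vx).
rewrite lerD2l -lee_fin fineK//; apply: outer_le.
  apply: openI => //; case: Wx => cx _ _.
  rewrite (_ : [set t | _] = [set t | 0 < d - x t]%R).
    apply: open_superlevel; apply: ctsB => //; exact: cts_cst.
  by apply/seteqP; split=> t /=; rewrite subr_gt0.
move=> t [Wt Ut]; split=> //=; case: Wx => _ _ -> // -[_ /Ut //].
Qed.

Lemma positive_functional_measure :
  exists m : {finite_measure set (borel K) -> \bar R},
    (forall U, open U -> m U = (open_content p U)%:E) /\
    (forall A (e : R), measurable (A : set (borel K)) -> (0 < e)%R ->
      exists U, [/\ open U, A `<=` U & m U <= m A + e%:E]).
Proof.
have muT : mu setT < +oo.
  by have -> : mu setT = _ := outer_open openT; exact: ltry.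
have [m mE] := outer_measure_borel outer_caratheodory muT.
exists m; split=> [U oU|A e mA e0]; first by rewrite mE; exact: outer_open.
have [U [oU AU Ue]] := outer_adherent A e0.
by exists U; split=> //; rewrite !mE; apply: le_trans Ue; exact: outer_le.
Qed.

End outer.

(** * A positive functional is the integral against its measure *)

Section bounded_integrals.
Context d (T : measurableType d) (R : realType).
Implicit Types (m : {finite_measure set T -> \bar R}) (f g : T -> R).

Lemma bounded_integrable m f (M : R) : measurable_fun setT f ->
  (forall t, `|f t| <= M) -> m.-integrable setT (EFin \o f).
Proof.
move=> mf fM; apply: measurable_bounded_integrable => //.
  by rewrite -ge0_fin_numE ?fin_num_measure.
exists M; split; first exact: num_real.
by move=> N MN t _; apply: le_trans (fM t) (ltW MN).
Qed.

Lemma Rintegral_indic m A : measurable A ->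
  \int[m]_t (\1_A t : R) = fine (m A).
Proof. by move=> mA; rewrite /Rintegral integral_indic// setIT. Qed.

Lemma indic_integrable m A : measurable A ->
  m.-integrable setT (EFin \o (\1_A : T -> R)).
Proof.
move=> mA; apply: (@bounded_integrable _ _ 1); first exact: measurable_indic.
by move=> t; rewrite indicE; case: (_ \in _); rewrite ?normr1 ?normr0.
Qed.

End bounded_integrals.

Section continuous_integrals.
Context {R : realType} {K : ptopologicalType}.
Implicit Types x y : K -> R.

Lemma continuous_measurable x : continuous x ->
  measurable_fun setT (x : borel K -> R).
Proof.
move=> cx; apply: (measurability _ (RGenOInfty.measurableE R)).
move=> _ [_ [c ->] <-]; rewrite setTI; apply: borel_open.
rewrite (_ : _ @^-1` _ = [set t | c < x t]); first exact: open_superlevel.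
by apply/seteqP; split=> t /=; rewrite in_itv/= andbT.
Qed.

Context (cK : compact [set: K]).

Lemma continuous_bounded x : continuous x -> exists M, forall t, `|x t| <= M.
Proof. by move=> cx; exact: (Cd_bounded (mkCd cK cx)). Qed.

Lemma continuous_integrable (m : {finite_measure set (borel K) -> \bar R}) x :
  continuous x -> m.-integrable setT (EFin \o x).
Proof.
move=> cx; have [M xM] := continuous_bounded cx.
exact: bounded_integrable (continuous_measurable cx) xM.
Qed.

Context {p : (K -> R) -> R} (pp : positive_functional p).
Context (m : {finite_measure set (borel K) -> \bar R}).
Context (mE : forall U, open U -> m U = (open_content p U)%:E).

(** One slice y = min(x, d) is removed at a time, leaving z = (x - d)^+. On the
    one hand y <= d, and y vanishes off {x > 0}, so that p y is at most d times
    the content of {x > 0}. On the other hand y = d on {x > d} = {z > 0}, so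
    that the integral of y pays for the error term of z. *)
Lemma functional_le_slice (d : R) n x : 0 < d -> cone x ->
  (forall t, x t <= n%:R * d) ->
  p x <= \int[m]_t x t + d * open_content p [set t | 0 < x t].
Proof.
move=> d0; elim: n x => [|n IH] x [cx x0] xn.
  have -> : x = fun=> 0.
    by apply/funext => t; apply/eqP; rewrite eq_le x0 andbT -[0](mul0r d) xn.
  rewrite (functional_cst pp)// mul0r addr_ge0//.
    by apply: Rintegral_ge0.
  by rewrite mulr_ge0 ?(ltW d0)// (open_content_ge0 pp).
pose y t := Num.min (x t) d.
have cy : cone y.
  split=> [|t]; first by apply: cts_min => //; exact: cts_cst.
  by rewrite le_min x0 ltW.
have cz := cone_trunc d cx.
have xE : x = fun t => y t + trunc d x t.
  apply/funext => t; rewrite /y /trunc.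
  by case: (leP (x t) d) => xd; [rewrite max_r ?addr0// subr_le0|
    rewrite max_l ?subrKC// subr_ge0 ltW].
have oz := open_superlevel d cx.
have zE : [set t | 0 < trunc d x t] = [set t | d < x t].
  by apply/seteqP; split=> t /=; rewrite /trunc lt_max ltxx orbF subr_gt0.
have iy := continuous_integrable m cy.1.
have iz := continuous_integrable m cz.1.
have py : p y <= d * open_content p [set t | 0 < x t].
  rewrite (_ : y = fun t => d * (d^-1 * y t)); last first.
    by apply/funext => t; rewrite mulVKf ?gt_eqF.
  have cdy : continuous (fun t => d^-1 * y t).
    by apply: ctsM; [exact: cts_cst|case: cy].
  have dy0 t : 0 <= d^-1 * y t by rewrite mulr_ge0 ?invr_ge0 ?(ltW d0)// cy.2.
  have [_ _ pZ] := pp; rewrite pZ ?(ltW d0)//.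
  rewrite ler_pM2l//; apply: (open_content_ub pp); split=> // t.
    by rewrite dy0/= mulrC ler_pdivrMr// mul1r ge_min lexx orbT.
  move=> /negP; rewrite -leNgt => xt0; rewrite (_ : y t = 0) ?mulr0//.
  by apply/eqP; rewrite eq_le; case: cy => _ ->; rewrite ge_min xt0.
have iyd : d * open_content p [set t | d < x t] <= \int[m]_t y t.
  have mz : measurable ([set t | d < x t] : set (borel K)) by exact: borel_open.
  have -> : open_content p [set t | d < x t] =
      fine (m [set t | d < x t]).
    by rewrite mE.
  rewrite -Rintegral_indic// -RintegralZl//; last exact: indic_integrable.
  apply: le_Rintegral => //.
    have := @integrableZl _ _ _ m setT measurableT d _ (indic_integrable m mz).
    by apply: eq_integrable.
  move=> t _; rewrite indicE /y; have [xd|xd] := ltP d (x t).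
    by rewrite mem_set// mulr1.
  by rewrite memNset ?mulr0// /=; apply/negP; rewrite -leNgt.
rewrite {1}xE; have [_ pD _] := pp; rewrite pD//.
rewrite (_ : \int[m]_t x t = \int[m]_t y t + \int[m]_t trunc d x t); last first.
  by rewrite {1}xE RintegralD.
have pz : p (trunc d x) <=
    \int[m]_t trunc d x t + d * open_content p [set t | d < x t].
  rewrite -zE; apply: IH => // t; rewrite ge_max; apply/andP; split.
    by rewrite lerBlDr (le_trans (xn t))// -natr1 mulrDl mul1r.
  by rewrite mulr_ge0// ltW.
lra.
Qed.

Lemma functional_integral x : cone x -> p x = \int[m]_t x t.
Proof.
have upper y : cone y -> p y <= \int[m]_t y t.
  move=> cy; apply/ler_addgt0Pr => e e0.
  have p1 : 0 <= open_content p setT by exact: (open_content_ge0 pp).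
  (* With this height the error d m(K) is at most e. *)
  pose d := e / (open_content p setT + 1).
  have d0 : 0 < d by rewrite divr_gt0// ltr_wpDl.
  have [M yM] := continuous_bounded cy.1.
  have yn t : y t <= (Num.bound (M / d))%:R * d.
    rewrite -ler_pdivrMr//; apply: le_trans (ltW (archi_boundP _)).
      by rewrite ler_pM2r ?invr_gt0// (le_trans (ler_norm _)).
    by rewrite divr_ge0 ?(ltW d0)// (le_trans _ (yM point)).
  apply: le_trans (functional_le_slice d0 cy yn) _.
  rewrite lerD2l; apply: (@le_trans _ _ (d * open_content p setT)).
    by rewrite ler_pM2l// (open_content_mono pp).
  rewrite /d -mulrA ler_piMr ?(ltW e0)// mulrC ler_pdivrMr ?mul1r ?lerDl//.
  exact: ltr_wpDl.
move=> cx; apply/eqP; rewrite eq_le upper//=.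
have [M xM] := continuous_bounded cx.1.
have M0 : 0 <= M by rewrite (le_trans _ (xM point)).
(* The reverse inequality is the same one for M - x. *)
have cB : cone (fun t => M - x t).
  split=> [|t]; first by apply: ctsB; [exact: cts_cst|case: cx].
  by rewrite subr_ge0 (le_trans (ler_norm _)).
have := upper _ cB.
have iM := continuous_integrable m (@cts_cst R K M).
rewrite RintegralB//; last exact: (continuous_integrable m cx.1).
have mT : fine (m setT) = p (fun=> 1).
  by rewrite mE ?(open_contentT pp)//; exact: openT.
rewrite Rintegral_cst// [X in M * X]mT.
have : p (fun=> M) = p (fun t => M - x t) + p x.
  have [_ pD _] := pp; rewrite -pD//.
  by congr p; apply/funext => t; rewrite subrK.
rewrite (functional_cst pp)//; lra.
Qed.

End continuous_integrals.

(** * Riesz representation of positive functionals, and parts of a functional *)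

Section riesz.
Context {R : realType} {K : ptopologicalType}.
Context (cK : compact [set: K]) (hK : hausdorff_space K).
Implicit Types x : K -> R.

(** Regularity from inside is regularity from outside of the complement. *)
Lemma outer_regular_charge (m : {finite_measure set (borel K) -> \bar R}) :
  (forall (A : set (borel K)) (e : R), measurable A -> 0 < e ->
    exists U : set K, [/\ open U, A `<=` U & (m U <= m A + e%:E)%E]) ->
  regular_charge (charge_of_finite_measure m).
Proof.
move=> mo A e mA e0; have e3 : 0 < e / 3 by rewrite divr_gt0.
have [U [oU AU mU]] := mo A _ mA e3.
have [V [oV AV mV]] := mo (~` A) _ (measurableC mA) e3.
exists (~` V), U; split => //; first exact: open_closedC.
  by rewrite -[A]setCK; exact: subsetC.
have bU := borel_open oU; have bV := borel_open oV.
have mUV : measurable (U `\` ~` V : set (borel K)).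
  by apply: measurableD => //; exact: measurableC.
have D (B W : set (borel K)) : measurable B -> measurable W -> B `<=` W ->
    (m W <= m B + (e / 3)%:E)%E -> (m (W `\` B) <= (e / 3)%:E)%E.
  move=> mB mW BW; rewrite measureD//; last by rewrite ltey_eq fin_num_measure.
  by rewrite (setIidr BW) leeBlDl ?fin_num_measure.
apply: (@le_lt_trans _ _ (m (U `\` ~` V))).
  apply: cvar_le => // B mB; rewrite gee0_abs//.
apply: (@le_lt_trans _ _ (m ((U `\` A) `|` (V `\` ~` A)))).
  apply: le_measure; [exact: mem_set| |].
    apply/mem_set/measurableU; apply: measurableD => //; exact: measurableC.
  move=> t [Ut /contrapT Vt]; have [At|At] := pselect (A t); last by left.
  by right; split=> // /(_ At).
apply: le_lt_trans (measureU2 _ _ _) _.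
- exact: measurableD.
- by apply: measurableD => //; exact: measurableC.
have DU := D _ _ mA bU AU mU; have DV := D _ _ (measurableC mA) bV AV mV.
apply: le_lt_trans (leeD DU DV) _.
rewrite -EFinD lte_fin; lra.
Qed.

Lemma riesz_positive (p : (K -> R) -> R) : positive_functional p ->
  exists m : {finite_measure set (borel K) -> \bar R},
    regular_charge (charge_of_finite_measure m) /\
    forall x, cone x -> p x = \int[m]_t x t.
Proof.
move=> pp; have [m [mE mo]] := positive_functional_measure cK hK pp.
exists m; split; first exact: outer_regular_charge.
by move=> x cx; exact: functional_integral.
Qed.

Implicit Types f : dual (Cd R cK).

(** On the cone this is the positive part of f in the order dual. *)
Definition upper f x : R :=
  sup [set f y | y in [set y : Cd R cK | forall t, 0 <= y t <= x t]].

Lemma upper_ub f x (y : Cd R cK) : cone x -> (forall t, 0 <= y t <= x t) ->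
  f y <= upper f x.
Proof.
move=> [cx x0] yx; apply: ub_le_sup; last by exists y.
have [B xB] := continuous_bounded cK cx.
have [M [M0 fM]] := dual_bounded f.
exists (M * (B + B)) => _ [z /= zx <-].
have zB t : `|z t| <= B.
  case/andP: (zx t) => z0 zxt.
  by rewrite ger0_norm// (le_trans zxt)// (le_trans (ler_norm _)).
apply: le_trans (ler_norm _) _; apply: le_trans (fM z) _.
rewrite ler_wpM2l//; apply: lerD; apply: supnorm_le => t.
  exact: le_trans (funrpos_le_norm _ _) (zB t).
exact: le_trans (funrneg_le_norm _ _) (zB t).
Qed.

Lemma upper_le f x M : cone x ->
  (forall y : Cd R cK, (forall t, 0 <= y t <= x t) -> f y <= M) ->
  upper f x <= M.
Proof.
move=> [cx x0] H; apply: ge_sup => [|_ [y yx <-]]; last exact: H.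
by exists (f 0), 0 => // t /=; rewrite lexx x0.
Qed.

Lemma coneD x y : cone x -> cone y -> cone (fun t => x t + y t).
Proof.
by move=> [cx x0] [cy y0]; split=> [|t]; [exact: ctsD|rewrite addr_ge0].
Qed.

Lemma coneZ (c : R) x : 0 <= c -> cone x -> cone (fun t => c * x t).
Proof.
move=> c0 [cx x0]; split=> [|t]; last by rewrite mulr_ge0.
by apply: ctsM => //; exact: cts_cst.
Qed.

(** Additivity is the Riesz decomposition property: what lies below x + y is
    the sum of its minimum with x, which lies below x, and of a remainder lying
    below y. *)
Lemma upper_positive f : positive_functional (upper f).
Proof.
split=> [x cx|x y cx cy|c x].
- rewrite -(linear0 f); apply: upper_ub => // t /=.
  by rewrite lexx cx.2.
- have cxy := coneD cx cy; apply/eqP; rewrite eq_le; apply/andP; split.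
    apply: upper_le => // z zxy.
    have cmin : continuous (fun t => Num.min (z t) (x t)).
      by apply: cts_min; [exact: Cd_cts|case: cx].
    pose z1 : Cd R cK := mkCd cK cmin.
    rewrite (_ : z = z1 + (z - z1)); last by rewrite addrC subrK.
    rewrite linearD lerD//; apply: upper_ub => // t.
      rewrite /= le_min ge_min lexx orbT andbT cx.2 andbT.
      by case/andP: (zxy t).
    change (0 <= z t - Num.min (z t) (x t) <= y t).
    rewrite subr_ge0 ge_min lexx/= lerBlDr; case/andP: (zxy t) => z0 zt.
    by case: (leP (z t) (x t)) => _; [rewrite lerDr cy.2|rewrite addrC].
  rewrite -lerBrDr; apply: upper_le => // z zx; rewrite lerBrDr addrC -lerBrDr.
  apply: upper_le => // w wy; rewrite lerBrDr -linearD.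
  apply: upper_ub => // t; case/andP: (zx t) => a b; case/andP: (wy t) => a' b'.
  change (0 <= w t + z t <= x t + y t).
  by rewrite addr_ge0// addrC lerD.
- rewrite le_eqVlt => /predU1P[<-{c}|c0] cx.
    rewrite mul0r; apply/eqP; rewrite eq_le; apply/andP; split.
      apply: upper_le => [|y y0]; first exact: coneZ.
      rewrite (_ : y = 0) ?linear0//; apply: CdP => t.
      change (y t = 0); apply/eqP; rewrite eq_le andbC.
      by have := y0 t; rewrite mul0r.
    rewrite -[X in X <= _](linear0 f).
    apply: upper_ub => [|t]; first exact: coneZ.
    by rewrite mul0r lexx.
  have ccx := coneZ (ltW c0) cx.
  apply/eqP; rewrite eq_le; apply/andP; split.
    apply: upper_le => // y yx.
    rewrite (_ : y = c *: (c^-1 *: y)); last first.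
      by rewrite scalerA divff ?gt_eqF// scale1r.
    rewrite linearZ/= [X in X <= _]/(_ *: _)/= ler_pM2l//.
    apply: upper_ub => // t.
    change (0 <= c^-1 * y t <= x t); case/andP: (yx t) => a b.
    by rewrite ler_pdivrMl// b mulr_ge0// invr_ge0 ltW.
  rewrite -ler_pdivlMl//; apply: upper_le => // y yx.
  rewrite ler_pdivlMl//.
  have -> : c * f y = f (c *: y) by rewrite linearZ.
  apply: upper_ub => // t; change (0 <= c * y t <= c * x t).
  case/andP: (yx t) => a b.
  by rewrite ler_pM2l// b mulr_ge0// ltW.
Qed.

(** The involution y |-> x - y of the functions between 0 and x turns - f y into
    f y - f x. *)
Lemma upperB f (x : Cd R cK) : (forall t, 0 <= x t) ->
  upper f x - upper (- f) x = f x.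
Proof.
move=> x0; have cx : cone x by split=> //; exact: Cd_cts.
have flip (y : Cd R cK) : (forall t, 0 <= y t <= x t) ->
    forall t, 0 <= (x - y : Cd R cK) t <= x t.
  move=> yx t; change (0 <= x t - y t <= x t); case/andP: (yx t) => a b.
  by rewrite subr_ge0 b gerBl.
suff H : upper (- f) x = upper f x - f x by rewrite H opprB subrKC.
apply/eqP; rewrite eq_le; apply/andP; split.
  apply: upper_le => // y /flip yx; change (- f y <= upper f x - f x).
  rewrite lerBrDl -linearB; exact: upper_ub.
rewrite lerBlDr; apply: upper_le => // y /flip yx; rewrite -lerBlDr.
have -> : f y - f x = (- f) (x - y).
  by change (f y - f x = - f (x - y)); rewrite linearB opprB.
exact: upper_ub.
Qed.

End riesz.

(** * Integration against a signed measure *)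

Section cintegral.
Context d (T : measurableType d) (R : realType).
Implicit Types (m : {finite_measure set T -> \bar R}) (f : T -> R).
Implicit Types nu : {charge set T -> \bar R}.

Section finite_sum.
Context (m1 m2 : {finite_measure set T -> \bar R}).

Let measure_add_fin : fin_num_fun (measure_add m1 m2).
Proof.
by move=> A mA; rewrite measure_addE fin_numD !fin_num_measure.
Qed.

HB.instance Definition _ := Measure.on (measure_add m1 m2).

HB.instance Definition _ := Measure_isFinite.Build _ _ _
  (measure_add m1 m2) measure_add_fin.

End finite_sum.

Lemma Rintegral_measure_add m1 m2 f (M : R) : measurable_fun setT f ->
  (forall t, `|f t| <= M) ->
  \int[measure_add m1 m2]_t f t = \int[m1]_t f t + \int[m2]_t f t.
Proof.
move=> mf fM; have i1 := bounded_integrable m1 mf fM.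
have i2 := bounded_integrable m2 mf fM.
rewrite /Rintegral (integral_measure_add measurableT i1 i2).
by rewrite fineD//; exact: integrable_fin_num.
Qed.

Lemma Rintegral_mscale (k : {nonneg R}) m f (M : R) : measurable_fun setT f ->
  (forall t, `|f t| <= M) ->
  \int[mscale k m]_t f t = k%:num * \int[m]_t f t.
Proof.
move=> mf fM.
(* Adding a constant makes the integrand nonnegative. *)
pose g t := f t + M; have g0 t : 0 <= g t.
  by rewrite /g -lerBlDr sub0r lerNl (le_trans _ (fM t))// -normrN ler_norm.
have iM (m' : {finite_measure set T -> \bar R}) :
    m'.-integrable setT (EFin \o (fun=> M)).
  by apply: (@bounded_integrable _ _ _ _ _ `|M|) => //; exact: measurable_cst.
have ig (m' : {finite_measure set T -> \bar R}) :
    \int[m']_t g t = \int[m']_t f t + M * fine (m' setT).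
  rewrite RintegralD//; last 2 first.
  - exact: (bounded_integrable m' mf fM).
  - exact: iM.
  by rewrite Rintegral_cst.
have : \int[mscale k m]_t g t = k%:num * \int[m]_t g t.
  rewrite /Rintegral ge0_integral_mscale//=.
  - rewrite fineM//; apply: integrable_fin_num => //.
    apply: (@bounded_integrable _ _ _ _ _ (M + M)).
      exact: measurable_funD.
    move=> t; rewrite ger0_norm ?g0// lerD2r (le_trans (ler_norm _))//.
  - by apply/measurable_EFinP; exact: measurable_funD.
  - by move=> t _; rewrite lee_fin g0.
rewrite !ig.
have -> : fine (mscale k m setT) = k%:num * fine (m setT).
  by rewrite /mscale fineM// fin_num_measure.
lra.
Qed.

Lemma jordanE nu A : measurable A -> nu A = (cpos nu A - cneg nu A)%E.
Proof.
by move=> mA; rewrite (jordan_decomp (hahnP nu) mA) /cadd/= cscaleN1.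
Qed.

Lemma sube_cross (a b c e : \bar R) : a \is a fin_num -> b \is a fin_num ->
  c \is a fin_num -> e \is a fin_num ->
  (a - b = c - e)%E -> (c + b = e + a)%E.
Proof.
move: a b c e => [a| |] [b| |] [c| |] [e| |]//= _ _ _ _ [H].
by congr EFin; lra.
Qed.

(** If nu = m1 - m2 = P - N, then P + m2 = N + m1 is an identity between finite
    measures, for which the integral is additive. *)
Lemma cintegral_diff nu m1 m2 f (M : R) : measurable_fun setT f ->
  (forall t, `|f t| <= M) ->
  (forall A, measurable A -> nu A = (m1 A - m2 A)%E) ->
  cintegral nu f = \int[m1]_t f t - \int[m2]_t f t.
Proof.
move=> mf fM nuE.
have E : \int[measure_add (cpos nu) m2]_t f t =
    \int[measure_add (cneg nu) m1]_t f t.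
  congr fine; apply: eq_measure_integral => A mA _.
  rewrite [LHS]measure_addE [RHS]measure_addE.
  apply: sube_cross; rewrite ?fin_num_measure//.
  by rewrite -nuE// jordanE.
have := Rintegral_measure_add (cneg nu) m1 mf fM.
rewrite -E (Rintegral_measure_add (cpos nu) m2 mf fM) /cintegral; lra.
Qed.

Lemma cintegral_linear (a : R) nu nu1 nu2 f (M : R) : measurable_fun setT f ->
  (forall t, `|f t| <= M) ->
  (forall A, measurable A -> nu A = (a%:E * nu1 A + nu2 A)%E) ->
  cintegral nu f = a * cintegral nu1 f + cintegral nu2 f.
Proof.
move=> mf fM nuE.
(* A negative factor exchanges the positive and the negative part. *)
have [k [P [N [E nuPN]]]] : exists (k : {nonneg R})
    (P N : {finite_measure set T -> \bar R}),
    a * cintegral nu1 f = k%:num * (\int[P]_t f t - \int[N]_t f t) /\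
    forall A, measurable A -> (a%:E * nu1 A = k%:num%:E * (P A - N A))%E.
  have [a0|/ltW a0] := leP 0 a.
    exists (NngNum a0), (cpos nu1), (cneg nu1); split=> // A mA.
    by rewrite jordanE.
  have b0 : 0 <= - a by rewrite oppr_ge0.
  exists (NngNum b0), (cneg nu1), (cpos nu1); split=> //=.
    by rewrite /cintegral mulNr -mulrN opprB.
  move=> A mA; rewrite jordanE// EFinN mulNe -muleN; congr (_ * _)%E.
  by rewrite fin_num_oppeB ?fin_numN ?fin_num_measure// addeC.
rewrite (@cintegral_diff nu (measure_add (mscale k P) (cpos nu2))
    (measure_add (mscale k N) (cneg nu2)) f M)//.
  rewrite [X in X - _](Rintegral_measure_add _ _ mf fM).
  rewrite [X in _ - X](Rintegral_measure_add _ _ mf fM).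
  rewrite E /cintegral !(Rintegral_mscale _ _ mf fM); lra.
move=> A mA; rewrite nuE// nuPN//.
rewrite [X in _ = (X - _)%E]measure_addE [X in _ = (_ - X)%E]measure_addE.
change (k%:num%:E * (P A - N A) + nu2 A = (k%:num%:E * P A + cpos nu2 A) -
  (k%:num%:E * N A + cneg nu2 A))%E.
rewrite (jordanE nu2)//.
rewrite -(fineK (fin_num_measure P A mA)) -(fineK (fin_num_measure N A mA)).
rewrite -(fineK (fin_num_measure (cpos nu2) A mA)).
rewrite -(fineK (fin_num_measure (cneg nu2) A mA)).
by congr EFin; lra.
Qed.

End cintegral.

(** * The two expressions of the norm, and the upper bound for integrals *)

Section dnorm.
Context {R : realType} {K : ptopologicalType}.
Implicit Types x : K -> R.

(** The supremum of x^+ s + x^- t over all s and t is the sum of the norms; such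
    a sum is a difference of values of x when x s >= 0 >= x t, and is at most
    the absolute value of one value of x otherwise. *)
Lemma dnormE x (M : R) : (forall t, `|x t| <= M) ->
  supnorm x^\+ + supnorm x^\- = Num.max (supnorm x) (diamnorm x).
Proof.
move=> xM.
have pM t : `|x^\+ t| <= M by exact: le_trans (funrpos_le_norm _ _) (xM t).
have nM t : `|x^\- t| <= M by exact: le_trans (funrneg_le_norm _ _) (xM t).
have sup_x t : `|x t| <= supnorm x by exact: supnorm_ge xM.
have sup_p t : x^\+ t <= supnorm x^\+.
  exact: le_trans (ler_norm _) (supnorm_ge _ pM).
have sup_n t : x^\- t <= supnorm x^\-.
  exact: le_trans (ler_norm _) (supnorm_ge _ nM).
have diam s t : `|x s - x t| <= diamnorm x.
  apply: ub_le_sup; last by exists s => //; exists t.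
  exists (M + M) => _ [a _ [b _ <-]].
  by rewrite (le_trans (ler_normB _ _))// lerD.
have xpn s t : x s - x t <= x^\+ s + x^\- t.
  by rewrite lerD// /funrpos /funrneg le_max lexx.
apply/eqP; rewrite eq_le; apply/andP; split; last first.
  rewrite ge_max; apply/andP; split.
    apply: supnorm_le => t.
    rewrite -[X in X <= _]/((Num.norm \o x) t) -funrposDneg.
    exact: lerD.
  apply: ge_sup.
    by exists `|x point - x point|, point => //; exists point.
  move=> _ [s _ [t _ <-]]; rewrite ler_norml lerNl opprB.
  by rewrite !(le_trans (xpn _ _))// lerD.
rewrite -lerBrDr; apply: supnorm_le => s; rewrite lerBrDr addrC -lerBrDr.
apply: supnorm_le => t; rewrite lerBrDr addrC.
rewrite !ger0_norm ?funrpos_ge0 ?funrneg_ge0//.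
rewrite le_max /funrpos /funrneg.
have [xs|xs] := leP (x s) 0.
  rewrite add0r; apply/orP; left; rewrite ge_max (le_trans _ (sup_x t)).
    by rewrite (le_trans _ (sup_x t)).
  by rewrite -normrN ler_norm.
have [xt|xt] := leP (- x t) 0.
  by rewrite addr0 (le_trans _ (sup_x s))// ler_norm.
by rewrite [X in _ || X](le_trans _ (diam s t)) ?ler_norm// orbT.
Qed.

End dnorm.

Section representation.
Context {R : realType} {K : ptopologicalType}.
Context (cK : compact [set: K]) (hK : hausdorff_space K).
Local Notation C := (Cd R cK).
Implicit Types (x : C) (nu : {charge set (borel K) -> \bar R}) (mu : rca R K).

Let ix (m : {finite_measure set (borel K) -> \bar R}) x :
  m.-integrable setT (EFin \o x).
Proof. by apply: (continuous_integrable cK); exact: Cd_cts. Qed.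

Lemma cintegral_linear_fun nu : linear (fun x : C => cintegral nu x : R^o).
Proof.
move=> a x y.
have E (m : {finite_measure set (borel K) -> \bar R}) :
    \int[m]_t (a *: x + y : C) t = a * \int[m]_t x t + \int[m]_t y t.
  rewrite -[LHS]/(\int[m]_t (a * x t + y t)).
  rewrite RintegralD//; [|exact: (ix m (a *: x))|exact: ix].
  by rewrite RintegralZl//; exact: ix.
rewrite /cintegral !E.
change (a * \int[cpos nu]_t x t + \int[cpos nu]_t y t -
  (a * \int[cneg nu]_t x t + \int[cneg nu]_t y t) =
  a * (\int[cpos nu]_t x t - \int[cneg nu]_t x t) +
  (\int[cpos nu]_t y t - \int[cneg nu]_t y t)).
lra.
Qed.

Lemma cintegral_le nu x : cintegral nu x <= maxnorm nu * `|x|.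
Proof.
have [M xM] := Cd_bounded x.
have pM t : `|x^\+ t| <= M by exact: le_trans (funrpos_le_norm _ _) (xM t).
have nM t : `|x^\- t| <= M by exact: le_trans (funrneg_le_norm _ _) (xM t).
have sup_p t : x t <= supnorm x^\+.
  apply: le_trans (supnorm_ge t pM); apply: le_trans (ler_norm _).
  by rewrite /funrpos le_max lexx.
have sup_n t : - supnorm x^\- <= x t.
  rewrite lerNl; apply: le_trans (supnorm_ge t nM).
  apply: le_trans (ler_norm _); by rewrite /funrneg le_max lexx.
have p0 : 0 <= supnorm x^\+.
  exact: le_trans (normr_ge0 _) (supnorm_ge point pM).
have n0 : 0 <= supnorm x^\-.
  exact: le_trans (normr_ge0 _) (supnorm_ge point nM).
have icst (m : {finite_measure set (borel K) -> \bar R}) (c : R) :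
    m.-integrable setT (EFin \o (fun=> c)).
  exact: (continuous_integrable cK m (@cts_cst R K c)).
have ub (m : {finite_measure set (borel K) -> \bar R}) :
    \int[m]_t x t <= supnorm x^\+ * fine (m setT).
  rewrite -Rintegral_cst//; apply: le_Rintegral => //.
    by first [exact: ix|exact: icst].
  by first [exact: ix|exact: icst].
have lb (m : {finite_measure set (borel K) -> \bar R}) :
    - supnorm x^\- * fine (m setT) <= \int[m]_t x t.
  rewrite -Rintegral_cst//; apply: le_Rintegral => //.
    by first [exact: ix|exact: icst].
  by first [exact: ix|exact: icst].
have Pm : fine (cpos nu setT) <= maxnorm nu.
  by rewrite /maxnorm !tvnorm_measure le_max lexx.
have Nm : fine (cneg nu setT) <= maxnorm nu.
  by rewrite /maxnorm !tvnorm_measure le_max lexx orbT.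
have := ub (cpos nu); have := lb (cneg nu).
have := ler_wpM2l p0 Pm; have := ler_wpM2l n0 Nm.
change `|x| with (supnorm x^\+ + supnorm x^\-).
rewrite /cintegral; lra.
Qed.

Lemma cintegral_bound nu x : `|cintegral nu x| <= maxnorm nu * `|x|.
Proof.
rewrite ler_norml cintegral_le andbT lerNl -(normrN x).
apply: le_trans (cintegral_le nu (- x)).
have := cintegral_linear_fun nu (-1) x 0.
rewrite addr0 scaleN1r => ->.
change (- cintegral nu x <= -1 * cintegral nu x + cintegral nu (0 : C)).
have := cintegral_linear_fun nu (-1) 0 0.
rewrite scaler0 addr0 => H0.
have : cintegral nu (0 : C) = - 1 * cintegral nu (0 : C) + cintegral nu (0 : C).
  exact: H0.
lra.
Qed.

End representation.

(** * Isometry and surjectivity of the canonical map *)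

Section isometry.
Context {R : realType} {K : ptopologicalType}.
Context (cK : compact [set: K]) (hK : hausdorff_space K).
Local Notation C := (Cd R cK).
Implicit Types (x : C) (mu : rca R K).

(** The functions g and 1_A agree off U `\` F, and differ by at most 1 there. *)
Lemma urysohn_integral (m : {finite_measure set (borel K) -> \bar R})
    (A F U : set (borel K)) (g : K -> R) :
  measurable A -> closed (F : set K) -> open (U : set K) -> F `<=` A ->
  A `<=` U -> below U g -> (forall t, F t -> g t = 1) ->
  `|\int[m]_t g t - fine (m A)| <= fine (m (U `\` F)).
Proof.
move=> mA cF oU FA AU [cg g01 g0] g1.
have mUF : measurable (U `\` F).
  by apply: measurableD; [exact: borel_open|exact: borel_closed].
have ig : m.-integrable setT (EFin \o g).
  exact: (continuous_integrable cK).
have iA := indic_integrable m mA.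
rewrite -!Rintegral_indic// -RintegralB//.
have igA : m.-integrable setT (EFin \o (fun t => g t - \1_A t)).
  exact: (integrableB measurableT ig iA).
apply: le_trans (le_normr_Rintegral _ igA) _ => //.
apply: le_Rintegral => //.
- exact: (integrable_norm igA).
- exact: indic_integrable.
move=> t _; rewrite !indicE.
have [Ft|Ft] := pselect (F t).
  by rewrite (mem_set (FA _ Ft)) g1// subrr normr0 ler0n.
have [Ut|Ut] := pselect (U t); last first.
  by rewrite g0// memNset ?subrr ?normr0 ?ler0n// => /AU.
rewrite (mem_set (_ : (U `\` F) t))//.
case/andP: (g01 t) => a b; rewrite ler_norml.
by case: (t \in A) => /=; apply/andP; split; lra.
Qed.

(** A Borel set is squeezed between a closed and an open set that differ little
    for the variation of mu; a Urysohn function between them has norm at most 1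
    and its integral approximates the charge of the Borel set. *)
Lemma maxnorm_le_cintegral mu (M : R) :
  (forall x, `|x| <= 1 -> `|cintegral mu x| <= M) -> maxnorm mu <= M.
Proof.
move=> H; apply/maxnorm_leP => A mA; apply/lee_addgt0Pr => e e0.
have [F [U [cF oU FA AU UFe]]] := @rca_regular _ _ mu A e mA e0.
have FU : F `<=` U by move=> t /FA/AU.
have [g gU g1] := @urysohn_below R K cK hK F U cF oU FU.
have [cg g01 g0] := gU.
pose x : C := mkCd cK cg.
have x1 : `|x| <= 1.
  change (supnorm g^\+ + supnorm g^\- <= 1); rewrite -[leRHS]addr0; apply: lerD.
    apply: supnorm_le => t; apply: le_trans (funrpos_le_norm _ _) _.
    by case/andP: (g01 t) => a b; rewrite ger0_norm.
  apply: supnorm_le => t; case/andP: (g01 t) => a b.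
  by rewrite /funrneg max_r ?normr0// oppr_le0.
have mUF : measurable (U `\` F : set (borel K)).
  by apply: measurableD; [exact: borel_open|exact: borel_closed].
have P := urysohn_integral (cpos mu) mA cF oU FA AU gU g1.
have N := urysohn_integral (cneg mu) mA cF oU FA AU gU g1.
have PN : fine (cpos mu (U `\` F)) + fine (cneg mu (U `\` F)) < e.
  rewrite -fineD ?fin_num_measure// -lte_fin fineK//.
  by rewrite fin_numD !fin_num_measure.
have := H x x1; rewrite jordanE//.
rewrite -(fineK (fin_num_measure (cpos mu) A mA)).
rewrite -(fineK (fin_num_measure (cneg mu) A mA)).
rewrite -EFinB abse_EFin -EFinD lee_fin.
change (cintegral mu x) with (\int[cpos mu]_t g t - \int[cneg mu]_t g t).
move: P N; rewrite !ler_norml => /andP[? ?] /andP[? ?] /andP[? ?].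
by apply/andP; split; lra.
Qed.

End isometry.

Section surjectivity.
Context {R : realType} {K : ptopologicalType}.
Context (cK : compact [set: K]) (hK : hausdorff_space K).

(** The charge is set to 0 off the Borel sets, as membership in [rca]
    requires. *)
Lemma difference_rca (m1 m2 : {finite_measure set (borel K) -> \bar R}) :
  regular_charge (charge_of_finite_measure m1) ->
  regular_charge (charge_of_finite_measure m2) ->
  exists mu : rca R K, forall A, measurable A -> mu A = (m1 A - m2 A)%E.
Proof.
move=> r1 r2.
pose c1 := charge_of_finite_measure m1; pose c2 := charge_of_finite_measure m2.
pose nu : {charge set (borel K) -> \bar R} :=
  crestr0 (cadd c1 (cscale (-1) c2)) measurableT.
have nuE (A : set (borel K)) : measurable A -> nu A = (m1 A - m2 A)%E.
  by move=> mA; rewrite /nu/= /crestr0 mem_set// /crestr setIT /cadd/= cscaleN1.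
have nureg : regular_charge nu.
  apply: (regular_le (a := 1%:nng) (b := 1%:nng) r1 r2) => A mA.
  rewrite nuE// !mul1e (le_trans (lee_abs_sub _ _))//.
  by apply: leeD; [exact: (cvar_ge c1)|exact: (cvar_ge c2)].
have nu0 (A : set (borel K)) : ~ measurable A -> nu A = 0%E.
  by move=> mA; rewrite /nu/= /crestr0 memNset.
by exists (Rca nureg nu0).
Qed.

Lemma riesz_signed (f : dual (Cd R cK)) :
  exists mu : rca R K, forall x : Cd R cK, f x = cintegral mu x.
Proof.
have [m1 [r1 E1]] := riesz_positive cK hK (upper_positive f).
have [m2 [r2 E2]] := riesz_positive cK hK (upper_positive (- f)).
have [mu muE] := difference_rca r1 r2; exists mu => x.
have [M xM] := Cd_bounded x.
rewrite (cintegral_diff (continuous_measurable (@Cd_cts _ _ _ x)) xM muE).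
have pos (y : Cd R cK) : (forall t, 0 <= y t) ->
    f y = \int[m1]_t y t - \int[m2]_t y t.
  by move=> y0; rewrite -(upperB f y0) E1 ?E2//; split=> //; exact: Cd_cts.
(* Adding a constant brings x into the cone. *)
pose c : Cd R cK := mkCd cK (@cts_cst R K M).
have c0 t : 0 <= c t by rewrite (le_trans _ (xM t)).
have xc0 t : 0 <= (x + c : Cd R cK) t.
  change (0 <= x t + M).
  by rewrite -lerBlDr sub0r lerNl (le_trans _ (xM t))// -normrN ler_norm.
have iD (m : {finite_measure set (borel K) -> \bar R}) :
    \int[m]_t (x + c : Cd R cK) t = \int[m]_t x t + \int[m]_t c t.
  by apply: RintegralD => //; apply: (continuous_integrable cK); exact: Cd_cts.
have fD : f (x + c) = f x + f c by rewrite linearD.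
by move: fD; rewrite (pos _ xc0) (pos c c0) !iD; lra.
Qed.

End surjectivity.

Theorem theorem5 (R : realType) (K : ptopologicalType)
  (cK : compact [set: K]) (hK : hausdorff_space K) :
  (forall x : Cd R cK,
     `|x| = supnorm x^\+ + supnorm x^\- /\
     supnorm x^\+ + supnorm x^\- = Num.max (supnorm x) (diamnorm x)) /\
  (exists Phi : {linear rca R K -> dual (Cd R cK)},
     (forall (mu : rca R K) (x : Cd R cK), Phi mu x = cintegral mu x) /\
     isometric_isomorphism Phi).
Proof.
split=> [x|].
  by split=> //; have [M xM] := Cd_bounded x; exact: dnormE xM.
have dualP (mu : rca R K) :
    (fun x : Cd R cK => cintegral mu x : R^o) \in dual_pred.
  apply/asboolP; split; first exact: cintegral_linear_fun.
  pose L : {linear Cd R cK -> R^o} := HB.pack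
    (fun x : Cd R cK => cintegral mu x : R^o)
    (GRing.isLinear.Build R (Cd R cK) R^o *:%R _
      (@cintegral_linear_fun R K cK mu)).
  apply/(@linear_bounded_continuous _ _ _ L)/linear_boundedP.
  exists (maxnorm mu); split; first exact: num_real.
  move=> r mr x; apply: le_trans (cintegral_bound mu x) _.
  by rewrite ler_wpM2r// ltW.
pose phi (mu : rca R K) : dual (Cd R cK) := Dual (dualP mu).
have phi_lin : linear phi.
  move=> a mu nu; apply/val_inj/funext => x.
  have [M xM] := Cd_bounded x.
  exact: (cintegral_linear (continuous_measurable (@Cd_cts _ _ _ x)) xM).
pose Phi : {linear rca R K -> dual (Cd R cK)} := HB.pack phi
  (GRing.isLinear.Build R (rca R K) (dual (Cd R cK)) *:%R phi phi_lin).
have isoPhi (mu : rca R K) : `|Phi mu| = `|mu|.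
  change (opnorm (phi mu) = maxnorm mu).
  apply/eqP; rewrite eq_le; apply/andP; split.
    apply: (opnorm_le (f := phi mu)) => x x1.
    apply: le_trans (cintegral_bound mu x) _; rewrite ler_piMr//.
    exact: (normr_ge0 mu).
  apply: (maxnorm_le_cintegral hK) => x x1.
  exact: (opnorm_ub (phi mu) x1).
exists Phi; split=> //; split=> //.
have surj (f : dual (Cd R cK)) : exists mu : rca R K, Phi mu = f.
  have [mu muE] := riesz_signed hK f.
  by exists mu; apply/val_inj/funext => x; exact: esym (muE x).
have [psi psiK] := choice surj; exists psi => // mu.
apply/eqP; rewrite -subr_eq0 -normr_eq0 -isoPhi linearB.
by rewrite psiK subrr normr0.
Qed.
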